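(* Let $n\ge1$ and let $B_n^{321}(q)=\sum_{\pi}q^{\mathrm{bump}(\pi)}$, the sum being over all $321$-avoiding permutations $\pi\in S_n$. The sequence of coefficients of the polynomial $B_n^{321}(q)$ is log-concave.
   Context: A sequence $(x_1,\ldots,x_m)$ is log-concave if $x_i^2\ge x_{i-1}x_{i+1}$ for all $1<i<m$. The sequence of coefficients of a polynomial lists the coefficients of $q^0,q^1,\ldots$ up to its degree. $S_n$ is the set of permutations $\pi=\pi_1\cdots\pi_n$ (one-line notation) of $\{1,\ldots,n\}$; $\pi$ is $321$-avoiding if there are no indices $a<b<c$ with $\pi_a>\pi_b>\pi_c$. Robinson–Schensted (RS) correspondence: tableaux are fillings of Young diagrams with distinct positive integers increasing along rows and down columns. To insert $k$ into a tableau $P$ (written $P\leftarrow k$), start with the top row: (I1) if $k$ is greater than or equal to the rightmost entry of the current row, or the current row is empty, append $k$ at the end of that row and stop; (I2) otherwise let $y$ be the leftmost entry of the current row with $k<y$, replace $y$ by $k$ (this is one bump), set $k:=y$, move down one row and go to (I1). For $\pi\in S_n$, let $P_0$ be the empty tableau and $P_i=P_{i-1}\leftarrow\pi_i$ for $1\le i\le n$. The statistic $\mathrm{bump}(\pi)$ is the total number of bumps that occur over all these insertions. *)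

(* Defs.v *)
From HB Require Import structures.
From mathcomp Require Import all_boot all_order all_fingroup all_algebra.

Set Implicit Arguments.
Unset Strict Implicit.
Unset Printing Implicit Defensive.

Import Order.TTheory GRing.Theory Num.Theory.

Local Open Scope ring_scope.

(* Entries are numbered from 0, so the internal entries of s are those of
   index i with 0 < i < (size s).-1. *)
Definition log_concave (s : seq int) : Prop :=
  forall i : nat, (0 < i)%N -> (i.+1 < size s)%N ->
    s`_i.-1 * s`_i.+1 <= s`_i ^+ 2.

Local Open Scope nat_scope.

(* A tableau is the list of its rows, from top to bottom. *)
Definition tableau := seq (seq nat).

(* P <- k, together with the number of bumps that the insertion causes; the
   rows below the last row of P are the empty current rows. *)
Fixpoint rs_insert (P : tableau) (k : nat) : tableau * nat :=
  if P is row :: P' then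
    if nilp row || (last 0 row <= k) then (rcons row k :: P', 0)
    else
      let j := find (fun y => k < y) row in
      let: (Q, b) := rs_insert P' (nth 0 row j) in
      (set_nth 0 row j k :: Q, b.+1)
  else ([:: [:: k]], 0).

(* The tableau obtained from P by successively inserting the letters of w,
   together with the total number of bumps. *)
Fixpoint rs_insert_word (P : tableau) (w : seq nat) : tableau * nat :=
  if w is k :: w' then
    let: (Q, b) := rs_insert P k in
    let: (Q', b') := rs_insert_word Q w' in
    (Q', b + b')
  else (P, 0).

(* 'S_n permutes {0, ..., n-1}; the shift by 1 gives letters in {1, ..., n}. *)
Definition one_line (n : nat) (pi : 'S_n) : seq nat :=
  [seq (pi i).+1 | i <- enum 'I_n].

Definition bump (n : nat) (pi : 'S_n) : nat :=
  (rs_insert_word [::] (one_line pi)).2.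

Definition avoids321 (n : nat) (pi : 'S_n) : bool :=
  ~~ [exists a : 'I_n, exists b : 'I_n, exists c : 'I_n,
        [&& a < b, b < c, pi b < pi a & pi c < pi b]].

Local Open Scope ring_scope.

Definition B321 (n : nat) : {poly int} :=
  \sum_(pi : 'S_n | avoids321 pi) 'X^(bump pi).

(* Main.v *)
Require Import Defs.
From HB Require Import structures.
From mathcomp Require Import all_boot all_order all_fingroup all_algebra.
From mathcomp Require Import zify.

Set Implicit Arguments.
Unset Strict Implicit.
Unset Printing Implicit Defensive.

(** The coefficient of 'X^k in B321 n is the square of a ballot number, and the
    ballot numbers of a fixed n form a log-concave sequence.

    A permutation avoids 321 exactly when no insertion ever opens a third row
    ([insert2_word_has321]).  An insertion into a tableau with two rows then
    causes one bump if it lengthens the second row and none otherwise, so that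
    the number of bumps is the final length of the second row
    ([rs_insert_word_bump]).

    It remains to count the permutations of 1, ..., n whose insertion tableau
    has two rows, the second of length k.  The last insertion can be undone: it
    either appended the last entry of the first row, or bumped the last entry of
    the second row.  Hence the words with a given insertion tableau T satisfy
    the same recurrence as the standard tableaux of the shape of T, which arise
    by adding the largest entry at the end of either row.  Both numbers are
    [ballot n k]; neither depends on the tableau T, only on its shape, so the
    permutations sought number [ballot n k ^ 2] ([card_bump]).

    The recurrence of [ballot] adds neighbours, like multiplication of a
    polynomial by 1 + q.  This operation preserves log-concavity in the
    strengthened form of [ballot_cross], and squaring all terms preserves it
    too. *)

(** * Insertion into tableaux with two rows *)

Notation two_rows := (seq nat * seq nat)%type.

Definition content (T : two_rows) : seq nat := T.1 ++ T.2.

(** Insertion that gives up when a third row would be opened. *)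
Definition insert2 (T : two_rows) (k : nat) : option two_rows :=
  let j := find (fun y => k < y) T.1 in
  if j < size T.1 then
    let y := nth 0 T.1 j in
    if all (fun z => z < y) T.2 then Some (set_nth 0 T.1 j k, rcons T.2 y)
    else None
  else Some (rcons T.1 k, T.2).

Definition insert2_word (w : seq nat) : option two_rows :=
  foldl (fun oT k => obind (insert2^~ k) oT) (Some ([::], [::])) w.

(** The last clause is the condition on columns, put as a ballot condition: the
    entries of the second row are matched, from the left, with smaller entries
    of the first row.  Unlike a comparison of entries position by position, it
    involves only the sets of entries of the rows, which makes it stable under
    the changes caused by an insertion. *)
Definition standard (T : two_rows) : bool :=
  [&& pairwise ltn T.1, pairwise ltn T.2, uniq (content T) &
    all (fun y => count (fun z => z < y) T.2 < count (fun x => x < y) T.1) T.2].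

Variant insert2_spec (k : nat) : two_rows -> option two_rows -> Prop :=
| Insert2Append R1 R2 of all (fun x => x <= k) R1 :
    insert2_spec k (R1, R2) (Some (rcons R1 k, R2))
| Insert2Bump A y B R2 of all (fun x => x <= k) A & k < y
    & all (fun z => z < y) R2 :
    insert2_spec k (A ++ y :: B, R2) (Some (A ++ k :: B, rcons R2 y))
| Insert2Fail A y B R2 z of all (fun x => x <= k) A & k < y
    & z \in R2 & y <= z :
    insert2_spec k (A ++ y :: B, R2) None.

Lemma set_nth_cat_cons (A B : seq nat) x y :
  set_nth 0 (A ++ x :: B) (size A) y = A ++ y :: B.
Proof. by elim: A => //= a A ->. Qed.

Lemma find_cat_cons (p : pred nat) A y B :
  all (predC p) A -> p y -> find p (A ++ y :: B) = size A.
Proof.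
by rewrite find_cat all_predC => /negPf-> /= ->; rewrite addn0.
Qed.

Lemma insert2P T k : insert2_spec k T (insert2 T k).
Proof.
case: T => R1 R2; rewrite /insert2 /= -has_find.
have [hasR1|] := boolP (has _ _); last first.
  rewrite -all_predC => R1k; constructor; apply: sub_all R1k => x /=.
  by rewrite -leqNgt.
case: (split_find_nth 0 hasR1) => y A B ky.
rewrite -all_predC => Ak; rewrite cat_rcons.
have Ak' : all (fun x => x <= k) A.
  by apply: sub_all Ak => x /=; rewrite -leqNgt.
rewrite find_cat_cons // set_nth_cat_cons.
have [yR2|/allPn[z zR2 yz]] := boolP (all _ R2); first exact: Insert2Bump.
by apply: (Insert2Fail B Ak' ky zR2); rewrite leqNgt.
Qed.

Lemma insert2_append R1 R2 k :
  all (fun x => x <= k) R1 -> insert2 (R1, R2) k = Some (rcons R1 k, R2).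
Proof.
move=> R1k; rewrite /insert2 /= -has_find ifN // -all_predC.
by apply: sub_all R1k => x /=; rewrite -leqNgt.
Qed.

Lemma insert2_bump A y B R2 k :
  all (fun x => x <= k) A -> k < y -> all (fun z => z < y) R2 ->
  insert2 (A ++ y :: B, R2) k = Some (A ++ k :: B, rcons R2 y).
Proof.
move=> Ak ky R2y; rewrite /insert2 /= find_cat_cons //.
  by rewrite nth_cat ltnn subnn /= set_nth_cat_cons R2y size_cat /= -ltn_subLR
     ?subnn.
by apply: sub_all Ak => x /=; rewrite -leqNgt.
Qed.

Lemma insert2_word_rcons w k :
  insert2_word (rcons w k) = obind (insert2^~ k) (insert2_word w).
Proof. by rewrite /insert2_word foldl_rcons. Qed.

Lemma insert2_content S k T :
  insert2 S k = Some T -> perm_eq (k :: content S) (content T).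
Proof.
case: insert2P => // [R1 R2 _|A y B R2 _ _ _] [<-]; apply/seq.permP => p;
  rewrite /content /= ?count_cat -?cats1 ?count_cat /= ?count_cat /=; lia.
Qed.

Lemma insert2_word_content w T :
  insert2_word w = Some T -> perm_eq w (content T).
Proof.
elim/last_ind: w T => [T [<-] //|w k IHw T].
rewrite insert2_word_rcons; case Ew: insert2_word => [S|] //= /insert2_content.
by apply: perm_trans; rewrite perm_rcons perm_cons; apply: IHw.
Qed.


Lemma count_increasing_lt (R : seq nat) (y z : nat) :
  all (fun x => x < y) R -> y <= z -> count (fun x => x < z) R = size R.
Proof.
move=> Ry yz; apply/eqP; rewrite -all_count; apply: sub_all Ry => x /= xy.
exact: leq_trans yz.
Qed.

Lemma count_mono_lt (R : seq nat) (y z : nat) :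
  y <= z -> count (fun x => x < y) R <= count (fun x => x < z) R.
Proof. by move=> yz; apply: sub_count => x /= xy; apply: leq_trans yz. Qed.


Lemma standard_last R1 R2 z :
  standard (R1, rcons R2 z) -> size R2 < count (fun x => x < z) R1.
Proof.
case/and4P=> /= _; rewrite pairwise_rcons all_rcons => /andP[R2z _] _.
by case/andP; rewrite -cats1 count_cat /= ltnn (count_increasing_lt R2z) ?addn0.
Qed.

Lemma standard_size T : standard T -> size T.2 <= size T.1.
Proof.
case: T => R1 R2; case/lastP: R2 => // R2 z /standard_last/=.
by rewrite size_rcons => /leq_trans-> //; apply: count_size.
Qed.

(** An entry bumped from the first row to the end of the second row lies weakly
    to the right of the column that it enters: at least [size R2] entries of the
    first row precede it. *)
Lemma standard_size_lt R1 R2 y :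
  standard (R1, R2) -> all (fun z => z < y) R2 ->
  size R2 <= count (fun x => x < y) R1.
Proof.
case/lastP: R2 => // R2 z /standard_last ltR2; rewrite all_rcons => /andP[zy _].
by rewrite size_rcons (leq_trans ltR2) // count_mono_lt // ltnW.
Qed.

Lemma insert2_standard S k T :
  standard S -> k \notin content S -> insert2 S k = Some T -> standard T.
Proof.
move=> stS kS ES; have := insert2_content ES; move: stS kS ES.
case: insert2P => // [R1 R2 R1k|A y B R2 Ak ky R2y] stS.
  case/and4P: stS => [/= incR1 incR2 uS bS].
  move=> kS [<-] /perm_uniq; rewrite cons_uniq kS uS => /esym uT.
  rewrite /standard uT /= pairwise_rcons incR1 incR2 !andbT.
  apply/andP; split.
    apply/allP=> x xR1; rewrite /= ltn_neqAle (allP R1k) // andbT.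
    by apply: contraNneq kS => <-; rewrite mem_cat xR1.
  apply: sub_all bS => z; rewrite -cats1 count_cat; lia.
have := standard_size_lt stS R2y.
case/and4P: stS => [/= incR1 incR2 uS bS].
move=> szR2 kS [<-] /perm_uniq; rewrite cons_uniq kS uS => /esym uT.
rewrite /standard uT /=.
move: incR1; rewrite !pairwise_cat !pairwise_rcons incR2 R2y /= !allrel_consr.
case/and3P=> /andP[Ay ->] -> /andP[yB ->]; rewrite !andbT.
have {}Ak : all (fun x => x < k) A.
  apply/allP=> x xA; rewrite ltn_neqAle (allP Ak) // andbT.
  by apply: contraNneq kS => <-; rewrite !mem_cat xA.
rewrite Ak /=; apply/andP; split.
  by apply: sub_all yB => x /= /(ltn_trans ky).
rewrite all_rcons -cats1 !count_cat (count_increasing_lt R2y) //= ltnn ky.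
move: szR2; rewrite count_cat /= ltnn => szR2; apply/andP; split; first lia.
apply/allP=> z zR2; have := allP bS z zR2; have := allP R2y z zR2.
rewrite !count_cat /=; lia.
Qed.

Lemma insert2_word_standard w T :
  uniq w -> insert2_word w = Some T -> standard T.
Proof.
elim/last_ind: w T => [T _ [<-] //|w k IHw T].
rewrite insert2_word_rcons rcons_uniq => /andP[kw uw].
case Ew: (insert2_word w) => [S|] //=; apply: insert2_standard (IHw S uw Ew) _.
by rewrite -(perm_mem (insert2_word_content Ew)).
Qed.

(** * Undoing an insertion *)

(** Each of the two functions below returns the tableau before the insertion
    together with the inserted letter. *)

Definition unappend (T : two_rows) : two_rows * nat :=
  ((take (size T.1).-1 T.1, T.2), last 0 T.1).

(** The letter that bumped the last entry y of the second row is the largest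
    entry of the first row that is smaller than y. *)
Definition unbump (T : two_rows) : two_rows * nat :=
  let y := last 0 T.2 in
  let j := (find (fun x => y < x) T.1).-1 in
  ((set_nth 0 T.1 j y, take (size T.2).-1 T.2), nth 0 T.1 j).

Lemma unappendE R1 R2 k : unappend (rcons R1 k, R2) = ((R1, R2), k).
Proof.
by rewrite /unappend /= size_rcons last_rcons /= -cats1 take_size_cat.
Qed.

Lemma unbumpE A x B R2 y :
  all (fun x => x <= y) (rcons A x) -> all (fun x => y < x) B ->
  unbump (A ++ x :: B, rcons R2 y) = ((A ++ y :: B, R2), x).
Proof.
move=> Axy yB.
rewrite /unbump /= last_rcons size_rcons -cats1 take_size_cat //=.
have -> : find (fun x => y < x) (A ++ x :: B) = (size A).+1.
  rewrite -cat_rcons find_cat ifN; last first.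
    by rewrite -all_predC; apply: sub_all Axy => z /=; rewrite leqNgt.
  by rewrite size_rcons; case: B yB => [|b B /= /andP[-> _]]; rewrite addn0.
by rewrite /= set_nth_cat_cons nth_cat ltnn subnn.
Qed.

(** The shape of T does not tell which of the two kinds of insertion came last,
    but once the kind is known, T determines S and k. *)
Lemma insert2_undo S k T :
  standard S -> insert2 S k = Some T ->
  size T.2 < size T.1 /\ unappend T = (S, k) \/
  0 < size T.2 /\ unbump T = (S, k).
Proof.
move=> stS; case: insert2P stS => // [R1 R2 R1k|A y B R2 Ak ky R2y] stS [<-].
  left; rewrite unappendE /= size_rcons ltnS; split=> //.
  exact: standard_size stS.
right; rewrite size_rcons unbumpE //.
  rewrite all_rcons (ltnW ky); apply: sub_all Ak => x /= xk.
  exact: leq_trans (ltnW ky).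
by case/and4P: stS; rewrite /= pairwise_cat /= => /and4P[_ _].
Qed.

Lemma unappend_standard T :
  standard T -> size T.2 < size T.1 ->
  standard (unappend T).1 /\ insert2 (unappend T).1 (unappend T).2 = Some T.
Proof.
case: T => R1 R2; case/lastP: R1 => // R1 k stT; rewrite unappendE /=.
rewrite size_rcons ltnS => szR; case/and4P: stT => /=.
rewrite pairwise_rcons => /andP[R1k incR1] incR2 uT bT; split; last first.
  by apply: insert2_append; apply: sub_all R1k => x /ltnW.
apply/and4P; split=> //=.
  by move: uT; rewrite /content /= cat_rcons -cat1s uniq_catCA => /andP[].
apply/allP=> y yR2; have := allP bT y yR2; rewrite -cats1 count_cat /=.
have [ky|] := ltnP k y; last by rewrite !addn0.
move=> _; rewrite (count_increasing_lt R1k (ltnW ky)).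
apply: leq_trans szR; rewrite ltn_neqAle count_size andbT -all_count.
by apply/allPn; exists y; rewrite ?ltnn.
Qed.

Lemma unbump_standard T :
  standard T -> 0 < size T.2 ->
  standard (unbump T).1 /\ insert2 (unbump T).1 (unbump T).2 = Some T.
Proof.
case: T => R1 R2; case/lastP: R2 => // R2 y stT _.
have [A [x [B [eR1 Ay xy yB]]]] : exists A x B,
  [/\ R1 = A ++ x :: B, all (fun z => z < y) A, x < y & all (fun z => y < z) B].
  have /= ltR2 := standard_last stT.
  case/and4P: stT => /= incR1 _ uT _.
  have yR1 : y \notin R1.
    move: uT; rewrite /content /= cat_uniq => /and3P[_ + _].
    by rewrite has_rcons negb_or => /andP[].
  elim/last_ind: R1 {uT} incR1 yR1 ltR2 => [|R1 x IH]; first by rewrite ltn0.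
  rewrite pairwise_rcons mem_rcons inE negb_or.
  move=> /andP[R1x incR1] /andP[yx yR1].
  have [xy _|] := ltnP x y.
    exists R1, x, [::]; split; rewrite ?cats1 //.
    by apply: sub_all R1x => z /= zx; apply: ltn_trans xy.
  rewrite leq_eqVlt (negPf yx) /= => yx'; rewrite -cats1 count_cat /=.
  rewrite (ltnNge x y) (ltnW yx') /= !addn0.
  case/(IH incR1 yR1)=> A [z [B [-> Ay zy yB]]].
  by exists A, z, (rcons B x); rewrite all_rcons yx' cats1 rcons_cat.
move: stT; rewrite {}eR1 => stT; rewrite unbumpE //; last first.
  by rewrite all_rcons (ltnW xy); apply: sub_all Ay => z /ltnW.
have ltR2 := standard_last stT.
case/and4P: stT => /=; rewrite !pairwise_cat !pairwise_rcons /= !allrel_consr.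
case/and3P=> /andP[Ax AB] incA /andP[xB incB] /andP[R2y incR2] uT bT.
have ins : insert2 (A ++ y :: B, R2) x = Some (A ++ x :: B, rcons R2 y).
  by apply: insert2_bump => //; apply: sub_all Ax => z /ltnW.
split=> //; apply/and4P; split=> //=.
- by rewrite pairwise_cat /= allrel_consr AB incA yB incB Ay.
- by move: uT; rewrite -(perm_uniq (insert2_content ins)) => /andP[].
- apply/allP=> z zR2; have zy := allP R2y z zR2.
  have : z \in rcons R2 y by rewrite mem_rcons inE zR2 orbT.
  move/(allP bT); move: ltR2.
  rewrite -cats1 !count_cat /= xy.
  have cBy : count (fun z => z < y) B = 0.
    apply/eqP; rewrite -leqn0 leqNgt -has_count; apply/hasPn=> b /(allP yB) /=.
    by rewrite -leqNgt => /ltnW.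
  have cBz : count (fun x => x < z) B = 0.
    apply/eqP; rewrite -leqn0 -cBy; apply: count_mono_lt; exact: ltnW.
  have cAy := count_increasing_lt Ay (leqnn y).
  have cR2 : count (fun x => x < z) R2 < size R2.
    rewrite ltn_neqAle count_size andbT -all_count.
    by apply/allPn; exists z; rewrite ?ltnn.
  have : x < z -> count (fun x => x < z) A = size A.
    by move=> xz; apply: count_increasing_lt Ax _; apply: ltnW.
  move: zy; rewrite /= cBy cBz cAy; lia.
Qed.

(** * Counting words and tableaux *)

(** The number of standard tableaux with rows of lengths n - k and k, by removal
    of the largest entry; it vanishes when the second row would be longer than
    the first. *)
Fixpoint ballot (n k : nat) : nat :=
  if n is n'.+1 then
    if k.*2 <= n then ballot n' k + (if k is k'.+1 then ballot n' k' else 0)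
    else 0
  else k == 0.

Lemma ballot_gt n k : n < k.*2 -> ballot n k = 0.
Proof. by case: n k => [|n] [|k] //=; rewrite ltnNge => /negPf->. Qed.

(** The words of length n with insertion tableau T, found by undoing the last
    insertion in all possible ways. *)
Fixpoint words (n : nat) (T : two_rows) : seq (seq nat) :=
  if n is n'.+1 then
    (if size T.2 < size T.1 then
       [seq rcons w (unappend T).2 | w <- words n' (unappend T).1] else [::]) ++
    (if 0 < size T.2 then
       [seq rcons w (unbump T).2 | w <- words n' (unbump T).1] else [::])
  else if T == ([::], [::]) then [:: [::]] else [::].

Lemma wordsS n T :
  words n.+1 T =
    (if size T.2 < size T.1 then
       [seq rcons w (unappend T).2 | w <- words n (unappend T).1] else [::]) ++
    (if 0 < size T.2 then
       [seq rcons w (unbump T).2 | w <- words n (unbump T).1] else [::]).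
Proof. by []. Qed.

Lemma mem_words n T (w : seq nat) :
  standard T -> size (content T) = n ->
  (w \in words n T) = (insert2_word w == Some T).
Proof.
elim: n T w => [|n IHn] T w stT szT.
  have eT : T = ([::], [::]).
    by case: T szT {stT} => [[|x R1] [|y R2]] //; rewrite size_cat ?addnS.
  rewrite /= eT eqxx mem_seq1; apply/eqP/eqP => [->|/insert2_word_content] //.
  by move/perm_size/size0nil.
have sz S k : insert2 S k = Some T -> size (content S) = n.
  by move/insert2_content/perm_size; rewrite szT => -[].
rewrite wordsS mem_cat; apply/orP/eqP.
  case; case: ifP => // szR /mapP[v + ->]; rewrite insert2_word_rcons.
    have [stS ins] := unappend_standard stT szR.
    by rewrite IHn // => [/eqP->//|]; apply: sz ins.
  have [stS ins] := unbump_standard stT szR.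
  by rewrite IHn // => [/eqP->//|]; apply: sz ins.
case/lastP: w => [[] eT|w k]; first by move: szT; rewrite -eT.
rewrite insert2_word_rcons; case Ew: insert2_word => [S|//] ins.
have {}ins : insert2 S k = Some T by [].
have uT : uniq (k :: content S).
  by rewrite (perm_uniq (insert2_content ins)); case/and4P: stT.
have stS : standard S.
  apply: (insert2_word_standard _ Ew).
  by case/andP: uT => _; rewrite (perm_uniq (insert2_word_content Ew)).
have wS : w \in words n S by rewrite IHn ?Ew //; apply: sz ins.
case: (insert2_undo stS ins) => -[-> eS]; [left|right]; rewrite eS /=;
  exact: map_f.
Qed.

Lemma uniq_words n T :
  standard T -> size (content T) = n -> uniq (words n T).
Proof.
elim: n T => [|n IHn] T stT szT; first by rewrite /=; case: ifP.
have sz S k : insert2 S k = Some T -> size (content S) = n.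
  by move/insert2_content/perm_size; rewrite szT => -[].
rewrite wordsS cat_uniq; apply/and3P; split.
- case: ifP => // lt; have [stS ins] := unappend_standard stT lt.
  by rewrite map_inj_uniq ?IHn // => [|u v /rcons_inj[]//]; apply: sz ins.
- case: ifP => [lt|_]; last by apply/hasPn.
  have [stS ins] := unappend_standard stT lt.
  case: ifP => [gt0|_ //]; have [stS' ins'] := unbump_standard stT gt0.
  (* a common word would have two insertion tableaux, with second rows of
     different lengths *)
  apply/hasPn=> _ /mapP[w + ->].
  rewrite mem_words // => [/eqP ew|]; last exact: sz ins'.
  apply/mapP=> -[v + /rcons_inj[ewv _]].
  rewrite -ewv mem_words //; last exact: sz ins.
  rewrite ew => /eqP[_ /(congr1 size)]; rewrite size_takel ?leq_pred //.
  by case: (size T.2) gt0 => // m _ /n_Sn.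
- case: ifP => // gt0; have [stS ins] := unbump_standard stT gt0.
  by rewrite map_inj_uniq ?IHn // => [|u v /rcons_inj[]//]; apply: sz ins.
Qed.

(** Undoing an append keeps the length of the second row and undoing a bump
    decreases it by one, whatever the entries are; this is the recurrence of
    [ballot]. *)
Lemma size_words n T :
  standard T -> size (content T) = n -> size (words n T) = ballot n (size T.2).
Proof.
elim: n T => [|n IHn] T stT szT.
  by case: T szT {stT} => [[|x R1] [|y R2]] //; rewrite size_cat ?addnS.
have sz S k : insert2 S k = Some T -> size (content S) = n.
  by move/insert2_content/perm_size; rewrite szT => -[].
have szR := standard_size stT; move: (szT); rewrite size_cat => szR12.
have le2 : (size T.2).*2 <= n.+1 by lia.
rewrite wordsS [RHS]/= le2.
rewrite size_cat; congr (_ + _).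
  case: ifP => [lt|ge]; last by rewrite ballot_gt //; lia.
  have [stS ins] := unappend_standard stT lt.
  by rewrite size_map IHn //; apply: sz ins.
case: ifP => [gt0|]; last by case: (size T.2).
have [stS ins] := unbump_standard stT gt0.
rewrite size_map IHn //; last exact: sz ins.
by rewrite /= size_takel ?leq_pred //; case: (size T.2) gt0.
Qed.

Fixpoint tableaux (n k : nat) : seq two_rows :=
  if n is n'.+1 then
    if k.*2 <= n then
      [seq (rcons T.1 n, T.2) | T <- tableaux n' k] ++
      (if k is k'.+1 then [seq (T.1, rcons T.2 n) | T <- tableaux n' k']
       else [::])
    else [::]
  else if k == 0 then [:: ([::], [::])] else [::].

Lemma size_tableaux n k : size (tableaux n k) = ballot n k.
Proof.
elim: n k => [|n IHn] [|k] //=; first by rewrite cats0 size_map addn0.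
by case: ifP => // _; rewrite size_cat !size_map !IHn.
Qed.

Lemma content_rcons1 R1 R2 m :
  perm_eq (content (rcons R1 m, R2)) (rcons (content (R1, R2)) m).
Proof.
apply/seq.permP => p.
by rewrite /content /= -!cats1 !count_cat /= addnAC.
Qed.

Lemma content_rcons2 R1 R2 m :
  content (R1, rcons R2 m) = rcons (content (R1, R2)) m.
Proof. by rewrite /content /= rcons_cat. Qed.

Lemma uniq_rcons_max (s : seq nat) m :
  all (fun x => x < m) s -> uniq (rcons s m) = uniq s.
Proof.
move=> sm; rewrite rcons_uniq; suff -> : m \notin s by [].
by apply/negP => /(allP sm); rewrite ltnn.
Qed.

Lemma standard_max1 R1 R2 m :
  all (fun x => x < m) (content (R1, R2)) ->
  standard (rcons R1 m, R2) = standard (R1, R2).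
Proof.
move=> Tm; rewrite /standard (perm_uniq (content_rcons1 _ _ _)).
rewrite uniq_rcons_max //= pairwise_rcons.
move: (Tm); rewrite all_cat => /andP[-> /allP R2m] /=; do 3! congr (_ && _).
apply: eq_in_all => y /R2m ym.
by rewrite -cats1 count_cat /= (ltnNge m y) (ltnW ym) !addn0.
Qed.

Lemma standard_max2 R1 R2 m :
  all (fun x => x < m) (content (R1, R2)) ->
  standard (R1, rcons R2 m) = standard (R1, R2) && (size R2 < size R1).
Proof.
move=> Tm; rewrite /standard content_rcons2 uniq_rcons_max //= pairwise_rcons.
move: (Tm); rewrite all_cat => /andP[R1m R2m]; rewrite R2m all_rcons /=.
have -> : count (fun z => z < m) (rcons R2 m) = size R2.
  by rewrite -cats1 count_cat /= ltnn (count_increasing_lt R2m) ?addn0.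
rewrite (count_increasing_lt R1m) // -!andbA; do 3! congr (_ && _).
rewrite andbC; congr (_ && _); apply: eq_in_all => y /(allP R2m) ym.
by rewrite -cats1 count_cat /= (ltnNge m y) (ltnW ym) !addn0.
Qed.

Lemma iota1S n : 1 :: iota 2 n = rcons (iota 1 n) n.+1.
Proof.
by rewrite -[LHS]/(iota 1 n.+1) -[in LHS](addn1 n) iotaD add1n cats1.
Qed.

Lemma increasing_max (R : seq nat) m :
  pairwise ltn R -> all (fun x => x <= m) R -> m \in R ->
  exists R', R = rcons R' m.
Proof.
case/lastP: R => // R x; rewrite pairwise_rcons all_rcons mem_rcons inE.
move=> /andP[Rx _] /andP[xm _] /predU1P[->|/(allP Rx)/=]; first by exists R.
by rewrite ltnNge xm.
Qed.

Lemma perm_rcons2 (s t : seq nat) x :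
  perm_eq (rcons s x) (rcons t x) = perm_eq s t.
Proof. by rewrite -!cats1 perm_cat2r. Qed.

Lemma mem_tableaux n k (T : two_rows) :
  (T \in tableaux n k) =
  [&& standard T, perm_eq (content T) (iota 1 n) & size T.2 == k].
Proof.
have ltn1 m (T' : two_rows) :
    perm_eq (content T') (iota 1 m) -> all (fun x => x < m.+1) (content T').
  by move/perm_all->; apply/allP=> x; rewrite mem_iota => /andP[].
have sz m (T' : two_rows) :
    perm_eq (content T') (iota 1 m) -> size T'.1 + size T'.2 = m.
  by move/perm_size; rewrite size_iota size_cat.
elim: n k T => [|n IHn] k T.
  apply/idP/and3P => [|[_ /perm_size + /eqP<-]] /=.
    by case: eqP => // ->; rewrite mem_seq1 => /eqP->.
  by case: T => -[|x R1] [|y R2] //; rewrite size_cat ?addnS.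
apply/idP/and3P => [|[stT pT /eqP szT]].
  rewrite /=; case: ifP => // le2; rewrite mem_cat => /orP[].
    case/mapP=> -[R1 R2]; rewrite IHn => /and3P[stR pR /eqP szR ->] /=.
    rewrite standard_max1 ?ltn1 // stR -szR; split=> //.
    rewrite (permPl (content_rcons1 _ _ _)) iota1S.
    by rewrite perm_rcons2.
  case: k le2 => // k le2 /mapP[[R1 R2]]; rewrite IHn.
  case/and3P=> [stR pR /eqP/= szR ->] /=.
  rewrite standard_max2 ?ltn1 // stR content_rcons2 iota1S perm_rcons2.
  rewrite -/(content (R1, R2)) size_rcons szR; split=> //.
  by have := sz _ _ pR => /=; lia.
have le2 : k.*2 <= n.+1.
  by have := standard_size stT; have := sz _ _ pT; lia.
rewrite /= le2 mem_cat.
have : n.+1 \in content T by rewrite (perm_mem pT) mem_iota; lia.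
have /= maxT := ltn1 _ _ pT.
case: T stT pT szT maxT => R1 R2 stT pT /= szT.
rewrite all_cat => /andP[/= maxR1 maxR2].
have [/= incR1 incR2 _ _] := and4P stT.
rewrite mem_cat => /orP[/(increasing_max incR1 maxR1)|
  /(increasing_max incR2 maxR2)] [R eR]; apply/orP; [left|right].
  move: stT pT; rewrite {}eR (permPl (content_rcons1 _ _ _)) /= iota1S.
  rewrite perm_rcons2 => + pR; rewrite standard_max1 ?ltn1 // => stR.
  by apply/mapP; exists (R, R2); rewrite // IHn stR pR szT eqxx.
move: stT pT szT; rewrite {}eR content_rcons2 /= iota1S perm_rcons2.
rewrite size_rcons => + pR <-; rewrite standard_max2 ?ltn1 // => /andP[stR _].
by apply/mapP; exists (R1, R); rewrite // IHn stR pR eqxx.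
Qed.

Lemma uniq_tableaux n k : uniq (tableaux n k).
Proof.
elim: n k => [|n IHn] k /=; first by case: ifP.
case: ifP => // _; rewrite cat_uniq map_inj_uniq ?IHn => [|[R1 R2] [Q1 Q2] /=].
  case: k => //= k; rewrite map_inj_uniq ?IHn => [|[R1 R2] [Q1 Q2] /=].
    rewrite andbT; apply/hasPn => _ /mapP[T + ->]; rewrite mem_tableaux.
    case/and3P=> _ /perm_mem eT _; apply/mapP=> -[S _ [/= eT1 _]].
    have := eT n.+1; rewrite mem_iota /content eT1 mem_cat mem_rcons inE eqxx.
    by rewrite add1n ltnn andbF.
  by case=> -> /rcons_inj[->].
by case=> /rcons_inj[->] ->.
Qed.

(** Through [mem_insertion_words], the permutations of 1, ..., n whose insertion
    tableau has two rows, the second of length k. *)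
Definition insertion_words (n k : nat) : seq (seq nat) :=
  flatten [seq words n T | T <- tableaux n k].

Lemma tableaux_standard n k T :
  T \in tableaux n k -> standard T /\ size (content T) = n.
Proof.
by rewrite mem_tableaux => /and3P[-> /perm_size-> _]; rewrite size_iota.
Qed.

Lemma size_insertion_words n k : size (insertion_words n k) = ballot n k ^ 2.
Proof.
rewrite size_flatten /shape -map_comp -mulnn -{1}size_tableaux.
have : {subset tableaux n k <= tableaux n k} by [].
elim: {1 3 4}(tableaux n k) => [|T Ts IHTs] //= sub.
rewrite mulSn IHTs => [|S STs]; last by rewrite sub ?inE ?STs ?orbT.
have T_in : T \in tableaux n k by rewrite sub ?mem_head.
have [stT szT] := tableaux_standard T_in.
rewrite size_words //; move: T_in.
by rewrite mem_tableaux => /and3P[_ _ /eqP->].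
Qed.

Lemma mem_insertion_words n k (w : seq nat) :
  w \in insertion_words n k <->
  perm_eq w (iota 1 n) /\ exists2 T, insert2_word w = Some T & size T.2 = k.
Proof.
split=> [/flatten_mapP[T T_in]|[pw [T ew szT]]].
  have [stT szT] := tableaux_standard T_in.
  rewrite mem_words // => /eqP ew; move: T_in; rewrite mem_tableaux.
  case/and3P=> _ pT /eqP kT; split; last by exists T.
  exact: perm_trans (insert2_word_content ew) pT.
have pT : perm_eq (content T) (iota 1 n).
  by rewrite -(permPl (insert2_word_content ew)).
have stT : standard T.
  by apply: insert2_word_standard ew; rewrite (perm_uniq pw) iota_uniq.
apply/flatten_mapP; exists T; first by rewrite mem_tableaux stT pT szT eqxx.
by rewrite mem_words ?ew // (perm_size pT) size_iota.
Qed.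

Lemma uniq_insertion_words n k : uniq (insertion_words n k).
Proof.
rewrite /insertion_words; have := uniq_tableaux n k.
have : {subset tableaux n k <= tableaux n k} by [].
elim: {1 3 4}(tableaux n k) => [|T Ts IHTs] //= sub /andP[TTs uTs].
have subTs : {subset Ts <= tableaux n k}.
  by move=> S STs; rewrite sub ?inE ?STs ?orbT.
have [stT szT] := tableaux_standard (sub T (mem_head _ _)).
rewrite cat_uniq uniq_words // IHTs // andbT; apply/hasPn => w.
case/flatten_mapP=> S STs; have [stS szS] := tableaux_standard (subTs S STs).
rewrite !mem_words // => /eqP->; apply: contra TTs => /eqP[<-].
by [].
Qed.

(** * Bumps are the entries of the second row *)

(** A tableau lists its nonempty rows only, while a pair has a second component
    even when there is no second row. *)
Variant rows_of : tableau -> two_rows -> Prop :=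
| RowsOf0 : rows_of [::] ([::], [::])
| RowsOf1 R1 : rows_of [:: R1] (R1, [::])
| RowsOf2 R1 R2 : rows_of [:: R1; R2] (R1, R2).

Lemma last_le (R : seq nat) k :
  all (fun x => x <= k) R -> nilp R || (last 0 R <= k).
Proof.
by case/lastP: R => // R x; rewrite all_rcons last_rcons orbC => /andP[->].
Qed.

Lemma rs_insert_rows P T k T' :
  rows_of P T -> standard T -> insert2 T k = Some T' ->
  rows_of (rs_insert P k).1 T' /\ size T'.2 = size T.2 + (rs_insert P k).2.
Proof.
move=> PT stT eT'; move: PT stT; case: insert2P eT' => //.
  move=> R1 R2 R1k [<-] PT _; have le := last_le R1k.
  case eT: _ / PT => [|R|R R']; case: eT => eR eR' /=; subst.
  - by split=> //; apply: RowsOf1.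
  - by rewrite le; split=> //; constructor.
  - by rewrite le addn0; split=> //; constructor.
move=> A y B R2 Ak ky R2y [<-] PT /and4P[/= incR1 _ _ _].
have gt : (nilp (A ++ y :: B) || (last 0 (A ++ y :: B) <= k)) = false.
  rewrite /nilp size_cat addnS /= last_cat /= leqNgt.
  have /allP yB : all (ltn y) B.
    by move: incR1; rewrite pairwise_cat => /and4P[_ _ ? _].
  have := mem_last y B; rewrite inE => /predU1P[->|/yB]; first by rewrite ky.
  by move/(ltn_trans ky)->.
have fj : find (fun x => k < x) (A ++ y :: B) = size A.
  by apply: find_cat_cons => //; apply: sub_all Ak => x /=; rewrite -leqNgt.
have le2 : nilp R2 || (last 0 R2 <= y).
  by apply: last_le; apply: sub_all R2y => x /ltnW.
move eR1 : (A ++ y :: B) PT gt fj => R1 PT gt fj.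
have nR1 : nth 0 R1 (size A) = y by rewrite -eR1 nth_cat ltnn subnn.
have sR1 : set_nth 0 R1 (size A) k = A ++ k :: B.
  by rewrite -eR1 set_nth_cat_cons.
case eT: _ / PT => [|R|R R']; case: eT => eR eR' /=; subst.
- by case: (A) eR.
- by rewrite gt fj nR1 sR1 /=; split=> //; constructor.
- by rewrite gt fj nR1 sR1 le2 /= size_rcons addn1; split=> //; constructor.
Qed.

Lemma insert2_fold_none w :
  foldl (fun oT k => obind (insert2^~ k) oT) None w = None.
Proof. by elim: w. Qed.

Lemma rs_insert_word_rows P T w T' :
  rows_of P T -> standard T -> uniq (content T ++ w) ->
  foldl (fun oT k => obind (insert2^~ k) oT) (Some T) w = Some T' ->
  size T'.2 = size T.2 + (rs_insert_word P w).2.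
Proof.
elim: w P T => [|k w IHw] P T PT stT uTw /=; first by case=> <-; rewrite addn0.
case ins: (insert2 T k) => [S|]; last by rewrite insert2_fold_none.
have [] := rs_insert_rows PT stT ins.
case: (rs_insert P k) => Q b /= QS szS eT'.
have kT : k \notin content T.
  by move: uTw; rewrite uniq_catC /= mem_cat negb_or => /andP[/andP[]].
have := IHw Q S QS (insert2_standard stT kT ins) _ eT'.
case: (rs_insert_word Q w) => Q' b' /= ->; first by rewrite szS addnA.
move: uTw; rewrite -cat1s uniq_catCA catA.
by rewrite -(perm_uniq (perm_cat (insert2_content ins) (perm_refl w))).
Qed.

Lemma rs_insert_word_bump w T :
  uniq w -> insert2_word w = Some T -> (rs_insert_word [::] w).2 = size T.2.
Proof.
by move=> uw eT; rewrite (rs_insert_word_rows RowsOf0 _ _ eT).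
Qed.

(** * Two rows suffice exactly for the words that avoid 321 *)

Definition has321 (w : seq nat) : Prop :=
  exists a b c, [/\ a < b, b < c, c < size w,
    nth 0 w b < nth 0 w a & nth 0 w c < nth 0 w b].

Lemma insert2_word_take w i :
  i < size w ->
  insert2_word (take i.+1 w) =
  obind (insert2^~ (nth 0 w i)) (insert2_word (take i w)).
Proof. by move=> iw; rewrite (take_nth 0) // insert2_word_rcons. Qed.

Lemma mem_content_take w i T z :
  i <= size w -> insert2_word (take i w) = Some T -> z \in content T ->
  exists2 a, a < i & nth 0 w a = z.
Proof.
move=> iw /insert2_word_content/perm_mem<- /(nthP 0)[a].
by rewrite size_takel // => ai <-; exists a; rewrite ?nth_take.
Qed.

Lemma nth_content_take w i T a :
  i <= size w -> insert2_word (take i w) = Some T -> a < i ->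
  nth 0 w a \in content T.
Proof.
move=> iw /insert2_word_content/perm_mem<- ai.
by rewrite -(nth_take 0 ai) mem_nth // size_takel.
Qed.

Lemma standard_take w i T :
  uniq w -> insert2_word (take i w) = Some T -> standard T.
Proof. by move=> uw; apply: insert2_word_standard; apply: take_uniq. Qed.

(** This is how a pattern 321 is detected: after the letters z > y have been read
    in this order, y stays in the first row and some entry of the second row
    exceeds it.  Indeed y enters when z lies in the first row, and then y bumps
    an entry, or when z lies already in the second row.  Later y cannot be
    bumped, since it could not be appended to the second row. *)
Lemma descent_in_rows w i T a b :
  i <= size w -> insert2_word (take i w) = Some T ->
  a < b -> b < i -> nth 0 w b < nth 0 w a ->
  nth 0 w b \in T.1 /\ exists2 z, z \in T.2 & nth 0 w b < z.
Proof.
elim: i T => // i IHi T iw; rewrite insert2_word_take //.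
case eS: insert2_word => [S|//] ins ab; rewrite ltnS leq_eqVlt.
have {}ins : insert2 S (nth 0 w i) = Some T by [].
case/predU1P=> [eb|bi] ba; last first.
  have := IHi S (ltnW iw) eS ab bi ba; move: ins.
  case: insert2P => // [R1 R2 _|A y B R2 Ak ky R2y] [<-] /= [bS [z zS bz]].
    by rewrite mem_rcons inE bS orbT; split=> //; exists z.
  split; last by exists z; rewrite // mem_rcons inE zS orbT.
  move: bS; rewrite !mem_cat !inE => /or3P[->//|/eqP eby|->];
    last by rewrite !orbT.
  by have := allP R2y z zS; rewrite -eby ltnNge (ltnW bz).
rewrite eb in ab ba *; have := nth_content_take (ltnW iw) eS ab.
move: ins ba; case: insert2P => // [R1 R2 R1k|A y B R2 Ak ky R2y] [<-] /= ba.
  rewrite mem_rcons inE eqxx mem_cat => /orP[/(allP R1k)|aR2].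
    by rewrite leqNgt ba.
  by split=> //; exists (nth 0 w a).
move=> _; rewrite mem_cat mem_head orbT; split=> //.
by exists y; rewrite ?mem_rcons ?mem_head.
Qed.

(** This is how a third row produces a pattern 321.  If z was bumped by k, then
    the entries y < z of the first row at that time satisfy y <= k < z, so z and
    k are the required letters; an entry y < z that arrives after z has been
    bumped comes after z in w. *)
Lemma inversion_of_rows w i T y z :
  uniq w -> i <= size w -> insert2_word (take i w) = Some T ->
  y \in T.1 -> z \in T.2 -> y < z ->
  exists a b, [/\ a < b, b < i, nth 0 w a = z & y <= nth 0 w b < z].
Proof.
move=> uw; elim: i T y z => [|i IHi] T y z iw; first by rewrite take0 => -[<-].
rewrite insert2_word_take //; case eS: insert2_word => [S|//] ins.
have {}ins : insert2 S (nth 0 w i) = Some T by [].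
have old : y \in S.1 -> z \in S.2 -> y < z ->
    exists a b, [/\ a < b, b < i.+1, nth 0 w a = z & y <= nth 0 w b < z].
  move=> yS zS yz.
  have [a [b [ab bi az byz]]] := IHi S y z (ltnW iw) eS yS zS yz.
  by exists a, b; split=> //; apply: ltnW.
have new : y <= nth 0 w i < z -> z \in content S ->
    exists a b, [/\ a < b, b < i.+1, nth 0 w a = z & y <= nth 0 w b < z].
  move=> yz /(mem_content_take (ltnW iw) eS)[a ai az].
  by exists a, i.
have stS := standard_take uw eS.
move: ins old new stS.
case: insert2P => // [R1 R2 R1k|A x B R2 Ak kx R2x] [<-] /=.
  move=> old new _; rewrite mem_rcons inE => /predU1P[eyk|/old//] zR2 yz.
  by apply: new; rewrite ?mem_cat ?zR2 ?orbT // -eyk leqnn.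
move=> old new /and4P[/= incR1 _ _ _].
rewrite mem_cat inE mem_rcons inE => yAB /predU1P[ezx|zR2] yz.
  rewrite ezx in yz new *; apply: new; last by rewrite !mem_cat inE eqxx orbT.
  rewrite kx andbT; move: yAB => /or3P[/(allP Ak)//|/eqP->//|yB].
  move: incR1; rewrite pairwise_cat.
  case/and3P=> _ _ /=/andP[/allP/(_ _ yB)/= xy _].
  by move: yz; rewrite ltnNge (ltnW xy).
case/or3P: yAB => [yA|/eqP eyk|yB].
- by apply: old; rewrite // mem_cat yA.
- by apply: new; rewrite ?mem_cat ?zR2 ?orbT // -eyk leqnn.
- by apply: old; rewrite // mem_cat inE yB !orbT.
Qed.

Lemma insert2_word_has321 w :
  uniq w -> has321 w <-> insert2_word w = None.
Proof.
move=> uw; split.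
  case=> a [b [c [ab bc cw ba cb]]].
  have -> : w = take c.+1 w ++ drop c.+1 w by rewrite cat_take_drop.
  rewrite /insert2_word foldl_cat -/(insert2_word _) insert2_word_take //.
  case eS: insert2_word => [S|]; last by rewrite insert2_fold_none.
  have [] := descent_in_rows (ltnW cw) eS ab bc ba.
  rewrite /= -[RHS](insert2_fold_none (drop c.+1 w)) => bS [z zS bz].
  congr foldl; move: bS zS (standard_take uw eS).
  case: insert2P => // [R1 R2 R1k|A y B R2 Ak ky R2y] /= bS zS.
    by have := allP R1k _ bS; rewrite leqNgt cb.
  case/and4P=> /= incR1 _ _ _.
  (* the bumped entry y is the least one exceeding the letter at c *)
  have yb : y <= nth 0 w b.
    move: bS; rewrite mem_cat inE => /or3P[/(allP Ak)|/eqP->//|bB].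
      by rewrite leqNgt cb.
    move: incR1; rewrite pairwise_cat => /and3P[_ _ /=/andP[/allP yB _]].
    exact/ltnW/yB.
  by have := allP R2y z zS; rewrite ltnNge (ltnW (leq_ltn_trans yb bz)).
(* consider the first insertion that fails *)
move=> ew; have : exists i, i <= size w /\ insert2_word (take i w) = None.
  by exists (size w); rewrite take_size.
case=> i []; elim: i {ew} => [|i IHi] iw; first by rewrite take0.
rewrite insert2_word_take //; case eS: insert2_word => [S|]; last first.
  by move=> _; apply: IHi; rewrite // ltnW.
move=> ins; have {ins} : insert2 S (nth 0 w i) = None by [].
have stS := standard_take uw eS.
have := inversion_of_rows uw (ltnW iw) eS; move: stS.
case: insert2P => // A y B R2 z Ak ky zR2 yz /and4P[_ _ uS _] inv _.
have {}yz : y < z.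
  rewrite ltn_neqAle yz andbT; apply: contraTneq uS => ->.
  rewrite cat_uniq !negb_and negbK; apply/orP; right; apply/orP; left.
  by apply/hasP; exists z; rewrite // mem_cat mem_head orbT.
have [|a [b [ab bi az /andP[yb bz]]]] := inv y z _ zR2 yz.
  by rewrite mem_cat mem_head orbT.
by exists a, b, i; split; rewrite ?az //; apply: leq_trans ky _.
Qed.

(** * The coefficients *)

Lemma nth_one_line n (pi : 'S_n) (i : 'I_n) : nth 0 (one_line pi) i = (pi i).+1.
Proof.
by rewrite (nth_map i) ?size_enum_ord // nth_ord_enum.
Qed.

Lemma size_one_line n (pi : 'S_n) : size (one_line pi) = n.
Proof. by rewrite size_map size_enum_ord. Qed.

Lemma uniq_one_line n (pi : 'S_n) : uniq (one_line pi).
Proof.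
by rewrite map_inj_uniq ?enum_uniq // => i j [/val_inj/perm_inj].
Qed.

Lemma one_line_inj n : injective (@one_line n).
Proof.
move=> pi rho eq_w; apply/permP=> i; apply/val_inj/succn_inj.
by rewrite -!nth_one_line eq_w.
Qed.

Lemma perm_one_line n (pi : 'S_n) : perm_eq (one_line pi) (iota 1 n).
Proof.
apply: uniq_perm; rewrite ?uniq_one_line ?iota_uniq //.
apply: (uniq_min_size (uniq_one_line pi) _ _).2.
  by move=> _ /mapP[i _ ->]; rewrite mem_iota /= add1n ltnS ltn_ord.
by rewrite size_iota size_one_line.
Qed.

Lemma one_line_surj n w :
  perm_eq w (iota 1 n) -> exists pi : 'S_n, one_line pi = w.
Proof.
move=> pw; have szw : size w = n by rewrite (perm_size pw) size_iota.
have ltw (i : 'I_n) : (nth 0 w i).-1 < n /\ 0 < nth 0 w i.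
  have : nth 0 w i \in w by rewrite mem_nth // szw.
  rewrite (perm_mem pw) mem_iota; lia.
pose f i := Ordinal (ltw i).1.
have inj_f : injective f.
  move=> i j /(congr1 val)/= e; apply/val_inj/eqP.
  have uw : uniq w by rewrite (perm_uniq pw) iota_uniq.
  rewrite -(nth_uniq 0 _ _ uw) ?szw ?ltn_ord //.
  by rewrite -(prednK (ltw i).2) -(prednK (ltw j).2) e.
exists (perm inj_f); apply: (@eq_from_nth _ 0); rewrite size_one_line ?szw //.
move=> i lt_in; rewrite (nth_one_line _ (Ordinal lt_in)) permE /=.
by rewrite prednK //; case: (ltw (Ordinal lt_in)).
Qed.

Lemma avoids321P n (pi : 'S_n) : avoids321 pi <-> ~ has321 (one_line pi).
Proof.
split=> [/existsPn av [a [b [c [ab bc]]]]|av].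
  rewrite size_one_line => lt_cn ba cb.
  have lt_bn := ltn_trans bc lt_cn; have lt_an := ltn_trans ab lt_bn.
  have /existsPn/(_ (Ordinal lt_bn))/existsPn/(_ (Ordinal lt_cn)) :=
    av (Ordinal lt_an).
  move: ba cb; rewrite (nth_one_line pi (Ordinal lt_an)).
  rewrite (nth_one_line pi (Ordinal lt_bn)) (nth_one_line pi (Ordinal lt_cn)).
  by rewrite !ltnS /= ab bc => -> ->.
apply/existsPn=> a; apply/existsPn=> b; apply/existsPn=> c; apply/negP.
case/and4P=> ab bc ba cb; apply: av; exists a, b, c.
by rewrite size_one_line !nth_one_line !ltnS; split.
Qed.

(** The two factors count the tableaux T of the given shape and the words with
    insertion tableau T. *)
Lemma card_bump n k :
  #|[set pi : 'S_n | avoids321 pi & Defs.bump pi == k]| = ballot n k ^ 2.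
Proof.
rewrite -size_insertion_words cardE -(size_map (@one_line n)).
apply: perm_size; apply: uniq_perm.
- by rewrite map_inj_uniq ?enum_uniq //; apply: one_line_inj.
- exact: uniq_insertion_words.
move=> w; apply/mapP/idP => [[pi]|].
  rewrite mem_enum inE => /andP[/avoids321P av /eqP bk] ->.
  apply/mem_insertion_words; split; first exact: perm_one_line.
  have uw := uniq_one_line pi.
  case eT: (insert2_word (one_line pi)) => [T|].
    by exists T; rewrite // -bk /Defs.bump (rs_insert_word_bump uw eT).
  by case: av; apply/insert2_word_has321.
case/mem_insertion_words => /one_line_surj[pi <-] [T eT szT].
have uw := uniq_one_line pi.
exists pi => //.
rewrite mem_enum inE /Defs.bump (rs_insert_word_bump uw eT) szT eqxx andbT.
by apply/avoids321P => /(insert2_word_has321 uw); rewrite eT.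
Qed.

Lemma coef_B321 n k : ((B321 n)`_k)%R = Posz (ballot n k ^ 2).
Proof.
rewrite /B321 coef_sum -card_bump cardsE -sum1_card.
rewrite -natz GRing.natr_sum [RHS]big_mkcondr /=; apply: eq_bigr => pi _.
by rewrite coefXn eq_sym; case: eqP.
Qed.

(** * Log-concavity *)

(** Log-concavity is the case i + 1 = j.  The general form also excludes internal
    zeros; without it, the sums of neighbours of a log-concave sequence need not
    be log-concave. *)
Lemma ballot_cross n i j :
  i <= j -> ballot n i * ballot n j.+1 <= ballot n i.+1 * ballot n j.
Proof.
elim: n i j => [|n IHn] i j le_ij; first by rewrite muln0.
have [le2|gt2] := leqP j.+1.*2 n.+1; last first.
  by rewrite [ballot n.+1 j.+1]ballot_gt ?muln0.
have [le2i le2i1 le2j] :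
    [/\ i.*2 <= n.+1, i.+1.*2 <= n.+1 & j.*2 <= n.+1] by split; lia.
pose prev k := if k is k'.+1 then ballot n k' else 0.
have step k : k.*2 <= n.+1 -> ballot n.+1 k = ballot n k + prev k.
  by move=> /= ->.
rewrite !step //=.
(* both sides contain the product of the i-th and j-th ballot numbers; the
   other summands are compared one by one *)
have h1 := IHn i j le_ij.
have h2 : prev i * ballot n j <= ballot n i * prev j.
  case: i j le_ij {le2 le2i le2i1 le2j h1} => [|i] [|j] //= ij; exact: IHn.
have h3 : prev i * ballot n j.+1 <= ballot n i.+1 * prev j.
  move: le_ij; rewrite leq_eqVlt => /predU1P[<-|lt_ij].
    by rewrite mulnC; case: (i).
  apply: (@leq_trans (ballot n i * ballot n j)).
    case: (i) lt_ij => [|i'] lt_ij //=; apply: IHn; lia.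
  by case: j lt_ij {le2 le2j h1 h2} => // j ij; apply: IHn.
nia.
Qed.

Theorem theorem24 (n : nat) (hn : (1 <= n)%N) : log_concave (B321 n).
Proof.
move=> [//|i] _ _; rewrite !coef_B321 /= GRing.expr2 -!PoszM lez_nat -!expnMn.
by rewrite leq_sqr; apply: ballot_cross.
Qed.
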